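(* Let $A$ be an srl-monoid and $a,b\in A$, and let $\theta(a,b)$ be the smallest congruence of $A$ containing $(a,b)$. Then for all $x,y\in A$, $(x,y)\in \theta(a,b)$ if and only if there exist $n,m\in\mathbb{N}$ such that $\square^{m}(s(a,b)^n)\leq s(x,y)$.
   Context: A commutative l-monoid is an algebra $(A,\wedge,\vee,\cdot,e)$ of type $(2,2,2,0)$ such that $(A,\wedge,\vee)$ is a lattice, $(A,\cdot,e)$ is a commutative monoid and $(a\vee b)\cdot c=(a\cdot c)\vee(b\cdot c)$ for all $a,b,c\in A$. An algebra $(A,\wedge,\vee,\cdot,\rightarrow,e)$ of type $(2,2,2,2,0)$ is an srl-monoid if $(A,\wedge,\vee,\cdot,e)$ is a commutative l-monoid and there is a subalgebra $Q$ of $(A,\wedge,\vee,\cdot,e)$ such that for all $a,b\in A$ the set $\{q\in Q: a\cdot q\leq b\}$ has a maximum and $a\rightarrow b$ equals this maximum. $s(a,b)=(a\rightarrow b)\wedge(b\rightarrow a)\wedge e$. $c^0=e$, $c^{n+1}=c\cdot c^n$. $\square(c)=e\rightarrow c$; $\square^0(c)=c$, $\square^1(c)=\square(c)$ and $\square^{k+1}(c)=\square(c)\cdot\square^k(c)$ for $k\ge1$. $\mathbb{N}=\{0,1,2,\dots\}$. *)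

(* Defs.v *)
From HB Require Import structures.
From mathcomp Require Import all_boot all_order.
From mathcomp Require Import boolp classical_sets.

Set Implicit Arguments.
Unset Strict Implicit.
Unset Printing Implicit Defensive.

Import Order.TTheory.
Import Algebra.

Local Open Scope classical_set_scope.
Local Open Scope group_scope.

HB.mixin Record Lattice_Monoid_isCommLMonoid (d : Order.disp_t) A
    of Order.Lattice d A & Monoid A := {
  clmulC : commutative (@mul A) ;
  clmulUl : left_distributive (@mul A) (@Order.join d A)
}.

#[short(type="commLMonoidType")]
HB.structure Definition CommLMonoid (d : Order.disp_t) :=
  { A of Lattice_Monoid_isCommLMonoid d A & Order.Lattice d A & Monoid A }.

Record clm_subalgebra (d : Order.disp_t) (A : commLMonoidType d) (Q : set A)
    : Prop := ClmSubalgebra {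
  subalg1 : Q 1 ;
  subalgM : forall p q, Q p -> Q q -> Q (p * q) ;
  subalgI : forall p q, Q p -> Q q -> Q (Order.meet p q) ;
  subalgU : forall p q, Q p -> Q q -> Q (Order.join p q)
}.

Definition is_maximum (d : Order.disp_t) (T : porderType d) (S : set T)
  (m : T) : Prop := S m /\ ubound S m.

(* The subalgebra Q is only required to exist: it is not part of the
   signature, hence plays no role in the notion of congruence below. *)
HB.mixin Record CommLMonoid_isSrlMonoid (d : Order.disp_t) A
    of CommLMonoid d A := {
  imp : A -> A -> A ;
  imp_subproof : exists Q : set A, clm_subalgebra Q /\
    forall a b : A, is_maximum [set q | Q q /\ (a * q <= b)%O] (imp a b)
}.

#[short(type="srlMonoidType")]
HB.structure Definition SrlMonoid (d : Order.disp_t) :=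
  { A of CommLMonoid_isSrlMonoid d A & CommLMonoid d A }.

Section SrlMonoidTheory.
Context {d : Order.disp_t} {A : srlMonoidType d}.
Implicit Types (a b c : A) (R : set (A * A)).

Definition srl_s a b : A := Order.meet (Order.meet (imp a b) (imp b a)) 1.

Definition box c : A := imp 1 c.

(* The recursion starts at k = 1: boxn 1 c is box c, not box c * c. *)
Fixpoint boxn (k : nat) c : A :=
  match k with
  | 0 => c
  | 1 => box c
  | k'.+1 => box c * boxn k' c
  end.

Record congruence R : Prop := Congruence {
  cong_refl : forall x, R (x, x) ;
  cong_sym : forall x y, R (x, y) -> R (y, x) ;
  cong_trans : forall x y z, R (x, y) -> R (y, z) -> R (x, z) ;
  cong_meet : forall x x' y y', R (x, x') -> R (y, y') ->
    R (Order.meet x y, Order.meet x' y') ;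
  cong_join : forall x x' y y', R (x, x') -> R (y, y') ->
    R (Order.join x y, Order.join x' y') ;
  cong_mul : forall x x' y y', R (x, x') -> R (y, y') ->
    R (x * y, x' * y') ;
  cong_imp : forall x x' y y', R (x, x') -> R (y, y') ->
    R (imp x y, imp x' y')
}.

Definition theta a b : set (A * A) := smallest congruence [set (a, b)].

(* smallest is an intersection; congruences are closed under intersection,
   so theta a b is itself a congruence. *)
Lemma theta_congruence a b : congruence (theta a b).
Proof.
split.
- by move=> x R [cR _]; exact: cong_refl.
- by move=> x y h R hR; apply: (cong_sym hR.1); exact: h.
- by move=> x y z h k R hR; apply: (cong_trans hR.1); [exact: h|exact: k].
- by move=> x x' y y' h k R hR; apply: (cong_meet hR.1); [exact: h|exact: k].
- by move=> x x' y y' h k R hR; apply: (cong_join hR.1); [exact: h|exact: k].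
- by move=> x x' y y' h k R hR; apply: (cong_mul hR.1); [exact: h|exact: k].
- by move=> x x' y y' h k R hR; apply: (cong_imp hR.1); [exact: h|exact: k].
Qed.

End SrlMonoidTheory.

(* Main.v *)
(** All values of [imp] lie in the subalgebra Q, and Q is the set of fixed
    points of [box]; so [srl_s a b] and its powers are fixed by [box], and
    [boxn m (srl_s a b ^+ n)] is again a power of [srl_s a b]. For [u] in Q with
    [u <= 1], residuation turns [u <= srl_s x y] into [x * u <= y] and
    [y * u <= x], from which one reads off that the pairs [(x, y)] such that
    [srl_s x y] is above a power of [srl_s a b] form a congruence containing
    [(a, b)]. Conversely a congruence relates [srl_s x y] to [1] exactly when it
    relates [x] to [y], since [y] is the join of [x * srl_s x y] and [y]. *)
Require Import Defs.
From HB Require Import structures.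
From mathcomp Require Import all_boot all_order.
From mathcomp Require Import boolp classical_sets.

Import Algebra.
Local Open Scope group_scope.

Import Order.TTheory.

Section CommLMonoid.
Set Implicit Arguments.
Unset Strict Implicit.
Context {d : Order.disp_t} {A : commLMonoidType d}.
Implicit Types a b c u : A.

Lemma clm_mul2r a b c : (a <= b)%O -> (a * c <= b * c)%O.
Proof. by move=> /join_idPl ab; rewrite -ab clmulUl leUr. Qed.

Lemma clm_mul2l a b c : (a <= b)%O -> (c * a <= c * b)%O.
Proof. by move=> ab; rewrite ![c * _]clmulC clm_mul2r. Qed.

Lemma clm_mul a b a' b' :
  (a <= a')%O -> (b <= b')%O -> (a * b <= a' * b')%O.
Proof.
by move=> aa' bb'; exact: le_trans (clm_mul2r _ aa') (clm_mul2l _ bb').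
Qed.

Lemma clm_mul_ler a u : (u <= 1)%O -> (a * u <= a)%O.
Proof. by move=> u1; rewrite -[leRHS]mulg1 clm_mul2l. Qed.

Lemma clm_expg_le1 u n : (u <= 1)%O -> (u ^+ n <= 1)%O.
Proof.
move=> u1; elim: n => [|n IHn]; first by rewrite expg0.
by rewrite expgS (le_trans (clm_mul_ler _ IHn)).
Qed.

End CommLMonoid.

Section SrlMonoid.
Set Implicit Arguments.
Unset Strict Implicit.
Context {d : Order.disp_t} {A : srlMonoidType d}.
Implicit Types a b c p q u v x y : A.

(** An intrinsic stand-in for the subalgebra, which the structure provides only existentially. *)
Definition boxed q := box q = q.

(** [box q] is the largest element of [Q] below [q], so it equals [q] exactly when [q] lies in
    [Q]. *)
Lemma imp_boxed : clm_subalgebra boxed /\ forall a b,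
  is_maximum [set q | boxed q /\ (a * q <= b)%O]%classic (imp a b).
Proof.
have [Q [sQ maxQ]] := @imp_subproof _ A.
suff <- : Q = boxed by [].
apply/funext => q; apply/propext; have [[Qbox]] := maxQ 1 q.
rewrite mul1g => box_le box_ub; split=> [Qq|<-//]; apply: le_anti.
by rewrite [(box q <= q)%O]box_le; apply: box_ub; split; rewrite ?mul1g.
Qed.

Lemma boxed_subalgebra : clm_subalgebra boxed.
Proof. by have [] := imp_boxed. Qed.

Lemma boxed_imp a b : boxed (imp a b).
Proof. by have [_ /(_ a b)[[]]] := imp_boxed. Qed.

Lemma le_imp q a b : boxed q -> (q <= imp a b)%O = (a * q <= b)%O.
Proof.
have [_ /(_ a b)[[_ imp_le] imp_ub]] := imp_boxed.
move=> Qq; apply/idP/idP => [q_le|q_le]; last exact: imp_ub.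
exact: le_trans (clm_mul2l a q_le) imp_le.
Qed.

Lemma mul_imp_le a b : (a * imp a b <= b)%O.
Proof. by rewrite -le_imp //; exact: boxed_imp. Qed.

Lemma boxed_srl_s a b : boxed (srl_s a b).
Proof.
have [Q1 _ QI _] := boxed_subalgebra.
by apply: (QI) Q1; apply: (QI); exact: boxed_imp.
Qed.

Lemma srl_s_le1 a b : (srl_s a b <= 1)%O.
Proof. exact: leIr. Qed.

Lemma srl_sC a b : srl_s a b = srl_s b a.
Proof. by rewrite /srl_s [Order.meet (imp a b) _]meetC. Qed.

Lemma srl_sxx a : srl_s a a = 1.
Proof.
have [Q1 _ _ _] := boxed_subalgebra.
by apply/meet_idPr; rewrite meetxx le_imp // mulg1.
Qed.

Lemma le_srl_s u x y : boxed u -> (u <= 1)%O ->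
  (u <= srl_s x y)%O = (x * u <= y)%O && (y * u <= x)%O.
Proof. by move=> Qu u1; rewrite !lexI u1 andbT !le_imp. Qed.

Lemma boxed_expg u n : boxed u -> boxed (u ^+ n).
Proof.
have [Q1 QM _ _] := boxed_subalgebra.
by move=> Qu; elim: n => [|n IHn]; rewrite ?expg0 // expgS; exact: QM.
Qed.

(** The index starts at 1 because [boxn 0 u] is [u], whereas [u ^+ 0] is [1]. *)
Lemma boxn_boxed u m : boxed u -> boxn m.+1 u = u ^+ m.+1.
Proof.
move=> Qu; elim: m => [|m IHm]; first by rewrite expg1 /= Qu.
by rewrite -[LHS]/(box u * boxn m.+1 u) Qu IHm -expgS.
Qed.

Definition le_power u : set (A * A) :=
  [set p | exists n, (u ^+ n <= srl_s p.1 p.2)%O]%classic.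

Lemma le_powerP u x y : boxed u -> (u <= 1)%O ->
  le_power u (x, y) <->
  exists n, (x * u ^+ n <= y)%O /\ (y * u ^+ n <= x)%O.
Proof.
move=> Qu u1; have E n := le_srl_s x y (boxed_expg n Qu) (clm_expg_le1 n u1).
by split=> -[n] h; exists n; [apply/andP; rewrite -E|rewrite /= E; apply/andP].
Qed.

(* The exponents witnessing two related pairs add up, as [u <= 1]. *)
Lemma congruence_le_power u : boxed u -> (u <= 1)%O -> congruence (le_power u).
Proof.
move=> Qu u1; have P x y := le_powerP x y Qu u1.
have un1 n : (u ^+ n <= 1)%O := clm_expg_le1 n u1.
have Qn n : boxed (u ^+ n) := boxed_expg n Qu.
have [_ QM _ _] := boxed_subalgebra.
have wl x y n m : (x * u ^+ n <= y)%O -> (x * u ^+ (n + m) <= y)%O.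
  by move=> h; rewrite expgnDr mulgA (le_trans (clm_mul_ler _ (un1 m))).
have wr x y n m : (x * u ^+ m <= y)%O -> (x * u ^+ (n + m) <= y)%O.
  by rewrite addnC; exact: wl.
split.
- by move=> x; exists 0; rewrite expg0 /= srl_sxx.
- by move=> x y [n] h; exists n; rewrite srl_sC.
- move=> x y z /P[n [xy yx]] /P[m [yz zy]]; apply/P; exists (n + m); split.
    by rewrite expgnDr mulgA (le_trans (clm_mul2r _ xy)).
  by rewrite addnC expgnDr mulgA (le_trans (clm_mul2r _ zy)).
(* For meets, monotonicity of the product is enough: each meetand is bounded separately. *)
- move=> x x' y y' /P[n [xx' x'x]] /P[m [yy' y'y]]; apply/P; exists (n + m).
  split; rewrite lexI.
    by rewrite (le_trans _ (wl _ _ _ m xx')) ?(le_trans _ (wr _ _ n _ yy'))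
      ?clm_mul2r ?leIl ?leIr.
  by rewrite (le_trans _ (wl _ _ _ m x'x)) ?(le_trans _ (wr _ _ n _ y'y))
    ?clm_mul2r ?leIl ?leIr.
- move=> x x' y y' /P[n [xx' x'x]] /P[m [yy' y'y]]; apply/P; exists (n + m).
  by split; rewrite clmulUl; apply: leU2; first [exact: wl|exact: wr].
- move=> x x' y y' /P[n [xx' x'x]] /P[m [yy' y'y]]; apply/P; exists (n + m).
  have E p q : p * q * u ^+ (n + m) = (p * u ^+ n) * (q * u ^+ m).
    by rewrite expgnDr -!mulgA; congr (_ * _); rewrite !mulgA [q * _]clmulC.
  by rewrite !E; split; exact: clm_mul.
- move=> x x' y y' /P[n [xx' x'x]] /P[m [yy' y'y]]; apply/P; exists (n + m).
  (* [imp] reverses the order in its first argument, hence [p'] on the left of the first premise.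
     The product with [u ^+ (n + m)] is boxed, so residuation applies to it. *)
  have half p p' q q' : (p' * u ^+ n <= p)%O -> (q * u ^+ m <= q')%O ->
      (imp p q * u ^+ (n + m) <= imp p' q')%O.
    move=> p'p qq'; rewrite le_imp; last by apply: QM => //; exact: boxed_imp.
    have -> : p' * (imp p q * u ^+ (n + m)) =
        (p' * u ^+ n) * imp p q * u ^+ m.
      rewrite expgnDr !mulgA; congr (_ * _).
      by rewrite -!mulgA [imp _ _ * _]clmulC.
    apply: le_trans qq'; apply: clm_mul2r.
    exact: le_trans (clm_mul2r _ p'p) (mul_imp_le _ _).
  by split; exact: half.
Qed.

Section Congruence.
Variables (R : set (A * A)) (cR : congruence R).

Lemma cong_expg x n : R (x, 1) -> R (x ^+ n, 1).
Proof.
move=> Rx1; elim: n => [|n IHn]; first by rewrite expg0; exact: cong_refl cR _.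
by rewrite expgS; have := cong_mul cR Rx1 IHn; rewrite mulg1.
Qed.

(** Joining both sides of [(u, 1)] with [v] yields [(v, 1)]. *)
Lemma cong_le1 u v : (u <= v)%O -> (v <= 1)%O -> R (u, 1) -> R (v, 1).
Proof.
move=> uv v1 Ru1; have := cong_join cR (cong_refl cR v) Ru1.
by rewrite (join_idPl uv) (join_idPr v1).
Qed.

Lemma cong_srl_s x y : R (x, y) <-> R (srl_s x y, 1).
Proof.
split=> [Rxy|Rs].
  (* With [1] read as [srl_s y y], compatibility with [imp] and meet suffices. *)
  rewrite -(srl_sxx y) /srl_s.
  apply: (cong_meet cR); last exact: cong_refl cR _.
  by apply: (cong_meet cR); apply: (cong_imp cR) => //; exact: cong_refl cR _.
have join_cong p q : R (srl_s p q, 1) -> R (q, Order.join p q).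
  move=> Rpq.
  have := cong_join cR (cong_mul cR (cong_refl cR p) Rpq)
    (cong_refl cR q).
  have /andP[pq _] : (p * srl_s p q <= q)%O && (q * srl_s p q <= p)%O.
    by rewrite -le_srl_s //; [exact: boxed_srl_s|exact: srl_s_le1].
  by rewrite mulg1 (join_idPr pq).
(* As [srl_s] is symmetric, both [x] and [y] are related to their join. *)
apply: (cong_trans cR (y := Order.join x y)).
  by rewrite joinC; apply: join_cong; rewrite srl_sC.
by apply: (cong_sym cR); exact: join_cong.
Qed.

End Congruence.

End SrlMonoid.

Theorem theorem4p8 (d : Order.disp_t) (A : srlMonoidType d) (a b x y : A) :
  theta a b (x, y) <->
  exists n m : nat, (boxn m (srl_s a b ^+ n) <= srl_s x y)%O.
Proof.
have Qs := boxed_srl_s a b; have s1 := srl_s_le1 a b.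
split=> [th|[n [m h]]].
  suff [n le_n] : le_power (srl_s a b) (x, y) by exists n, 0.
  apply: th; split; first exact: congruence_le_power.
  by move=> _ ->; exists 1%N; rewrite expg1.
move=> R [cR /(_ _ erefl)/(cong_srl_s cR) Rs1].
apply/(cong_srl_s cR); apply: (cong_le1 cR h (srl_s_le1 x y)).
(* For positive [m], the boxed term is a power of a power of [srl_s a b], so it stays related to
   [1]. *)
case: m {h} => [|m]; first exact: (cong_expg cR).
rewrite boxn_boxed; last exact: boxed_expg.
by do 2!apply: (cong_expg cR).
Qed.
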